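(* There exist absolute constants $\kappa_1,\kappa_2>0$ such that for all $c_1\ge\kappa_1$, $c_2\ge\kappa_2$ there exists a constant $C>0$, depending only on $c_1$ and $c_2$, such that for all integers $r\ge2$, $n\ge3$ and $k\in\{3,\dots,n\}$, the estimator $\tilde s$ computed with the EI strategy (with constants $c_1,c_2$ in the penalty) satisfies $$\sup_{s\in\mathcal{P}_k}\mathbb{E}_s\|s-\tilde s\|^2\le C\inf_{\hat s}\sup_{s\in\mathcal{P}_k}\mathbb{E}_s\|s-\hat s\|^2,$$ where the infimum is taken over all estimators $\hat s$.
   Context: Model. $n\ge1$, $r\ge2$ are integers. $X_1,\dots,X_n$ are independent random column vectors, $X_i\in\{0,1\}^r$ with components summing to one. $X$ is the $r\times n$ random matrix with $i$th column $X_i$ and $s$ is its expectation (so each column of $s$ is a probability on $\{1,\dots,r\}$, and $s$ determines the law of $X$). $\mathbb{P}_s,\mathbb{E}_s$ denote probability and expectation when the mean of $X$ is $s$. An estimator is a function of $X$ with values in the $r\times n$ real matrices. For an $r\times n$ matrix $t$, $t^{(j)}$ is its $j$th line (a vector of $\mathbb{R}^n$, also viewed as the function $i\mapsto t_i^{(j)}$), $t_i$ its $i$th column; $\langle t,t'\rangle=\sum_{i,j}t_i^{(j)}t_i'^{(j)}$ and $\|\cdot\|$ is the associated norm. For a linear subspace $S\subset\mathbb{R}^n$, $\mathbb{R}^r\otimes S$ is the set of $r\times n$ matrices all of whose lines belong to $S$. Class $\mathcal{P}_k$. For a positive integer $k$, $\mathcal{P}_k$ is the set of $r\times n$ matrices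 $t$ such that every column of $t$ is a probability on $\{1,\dots,r\}$ and there exists a partition of $\{1,\dots,n\}$ into $k$ intervals on which all the functions $t^{(j)}$, $j=1,\dots,r$, are constant. Penalized estimator. Given a finite collection $\{S_m,m\in\mathcal{M}\}$ of linear subspaces of $\mathbb{R}^n$ with $D_m=\dim S_m$ and a penalty $\mathrm{pen}:\mathcal{M}\to\mathbb{R}_+$, $\hat s_m$ is the orthogonal projection of $X$ onto $\mathbb{R}^r\otimes S_m$, $\gamma_n(t)=\|t\|^2-2\langle X,t\rangle$, and $\tilde s=\hat s_{\hat m}$ where $\hat m$ minimizes $\gamma_n(\hat s_m)+\mathrm{pen}(m)$ over $m\in\mathcal{M}$. EI strategy. $\mathcal{M}$ is the collection of all partitions of $\{1,\dots,n\}$ into intervals; for $m\in\mathcal{M}$, $S_m$ is the linear span of the indicator vectors $\psi_I\in\mathbb{R}^n$, $I\in m$ ($i$th component of $\psi_I$ is $1$ if $i\in I$, $0$ otherwise), so $D_m=|m|$; and $\mathrm{pen}(m)=D_m\left(c_1\log\left(\frac{n}{D_m}\right)+c_2\right)$. *)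

(* Defs.v *)
From mathcomp Require Import all_boot all_order all_algebra.
From mathcomp Require Import boolp classical_sets reals constructive_ereal ereal.
From mathcomp Require Import exp.

Set Implicit Arguments.
Unset Strict Implicit.
Unset Printing Implicit Defensive.

Import Order.TTheory GRing.Theory Num.Theory.
Local Open Scope ring_scope.

Section Model.
Variables (R : realType) (r n : nat).
Implicit Types (s t x : 'M[R]_(r, n)).

Definition inner t t' : R := \sum_(i < n) \sum_(j < r) t j i * t' j i.

(* The library's norm `|t| on matrices is the sup norm. *)
Definition norm2 t : R := Num.sqrt (inner t t).

Definition prob_columns t : Prop :=
  forall i : 'I_n, (forall j : 'I_r, 0 <= t j i) /\ \sum_(j < r) t j i = 1.

(* A vector of {0,1}^r whose components sum to one is determined by the
   position of its single 1, so the possible values of X are coded by the maps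
   w : 'I_n -> 'I_r giving these positions. *)
Definition outcome := {ffun 'I_n -> 'I_r}.

Definition Xval (w : outcome) : 'M[R]_(r, n) := \matrix_(j, i) (w i == j)%:R.

(* Law of X when its columns are independent and E X = s, that is
   P(X_i = e_j) = s j i; see expect_indep and expect_mean. *)
Definition law s (w : outcome) : R := \prod_(i < n) s (w i) i.

Definition expect s (f : 'M[R]_(r, n) -> R) : R :=
  \sum_(w : outcome) law s w * f (Xval w).

Definition estimator := 'M[R]_(r, n) -> 'M[R]_(r, n).

Definition risk s (shat : estimator) : R :=
  expect s (fun x => norm2 (s - shat x) ^+ 2).

Definition sup_risk (P : set 'M[R]_(r, n)) (shat : estimator) : \bar R :=
  ereal_sup [set (risk s shat)%:E | s in P]%classic.

Definition minimax_risk (P : set 'M[R]_(r, n)) : \bar R :=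
  ereal_inf (range (sup_risk P)).

(* R^r (x) S *)
Definition in_tensor (S : {vspace 'rV[R]_n}) t : Prop :=
  forall j : 'I_r, row j t \in S.

Definition is_orthproj (S : {vspace 'rV[R]_n}) x p : Prop :=
  in_tensor S p /\ forall t, in_tensor S t -> inner (x - p) t = 0.

(* The default value 0 of xget is immaterial: the projection always exists,
   and it is unique. *)
Definition orthproj (S : {vspace 'rV[R]_n}) x : 'M[R]_(r, n) :=
  xget 0 [set p | is_orthproj S x p]%classic.

Definition contrast x t : R := norm2 t ^+ 2 - 2 * inner x t.

Section Penalized.
Variables (M : finType) (Ms : {set M}) (S : M -> {vspace 'rV[R]_n}).
Variable pen : M -> R.

Definition criterion x (m : M) : R := contrast x (orthproj (S m) x) + pen m.

Definition is_selected x (m : M) : Prop :=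
  m \in Ms /\ forall m', m' \in Ms -> criterion x m <= criterion x m'.

(* The minimizer need not be unique; any way of breaking ties is allowed. *)
Definition is_penalized_estimator (st : estimator) : Prop :=
  forall w : outcome, exists2 m,
    is_selected (Xval w) m & st (Xval w) = orthproj (S m) (Xval w).

End Penalized.

Definition is_interval (J : {set 'I_n}) : bool :=
  [forall a in J, forall c in J, forall b : 'I_n,
    ((a <= b) && (b <= c))%N ==> (b \in J)].

Definition interval_partitions : {set {set {set 'I_n}}} :=
  [set m : {set {set 'I_n}} |
    finset.partition m [set: 'I_n] && [forall J in m, is_interval J]].

Definition pw_const_class (k : nat) : set 'M[R]_(r, n) :=
  [set t | prob_columns t /\
    exists m : {set {set 'I_n}},
      [/\ m \in interval_partitions, #|m| = k &
          forall J, J \in m -> forall i i', i \in J -> i' \in J ->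
          forall j : 'I_r, t j i = t j i']]%classic.

Definition psi (J : {set 'I_n}) : 'rV[R]_n := \row_i (i \in J)%:R.

Definition hist_space (m : {set {set 'I_n}}) : {vspace 'rV[R]_n} :=
  <<[seq psi J | J <- enum m]>>%VS.

Definition EI_pen (c1 c2 : R) (m : {set {set 'I_n}}) : R :=
  let D : R := (\dim (hist_space m))%:R in D * (c1 * ln (n%:R / D) + c2).

Definition is_EI_estimator (c1 c2 : R) (st : estimator) : Prop :=
  is_penalized_estimator interval_partitions hist_space (EI_pen c1 c2) st.

Lemma expect_prod s (f : 'I_n -> 'cV[R]_r -> R) :
  expect s (fun x => \prod_i f i (col i x)) =
  \prod_i \sum_j s j i * f i (delta_mx j 0).
Proof.
rewrite bigA_distr_bigA; apply: eq_bigr => w _; rewrite -big_split /=.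
apply: eq_bigr => i _; congr (_ * f i _).
by apply/colP => j; rewrite !mxE eqxx andbT eq_sym.
Qed.

Lemma expect_col s (i : 'I_n) (f : 'cV[R]_r -> R) : prob_columns s ->
  expect s (fun x => f (col i x)) = \sum_j s j i * f (delta_mx j 0).
Proof.
move=> Ps; pose g i' v := if i' == i then f v else 1.
transitivity (expect s (fun x => \prod_i' g i' (col i' x))).
  apply: eq_bigr => w _; congr (_ * _).
  rewrite (bigD1 i) //= /g eqxx big1 ?mulr1 // => i' /negPf -> //.
rewrite expect_prod (bigD1 i) //= /g eqxx [X in _ * X]big1 ?mulr1 // => i' /negPf ->.
by under eq_bigr do rewrite mulr1; case: (Ps i').
Qed.

Lemma expect_indep s (f : 'I_n -> 'cV[R]_r -> R) : prob_columns s ->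
  expect s (fun x => \prod_i f i (col i x)) =
  \prod_i expect s (fun x => f i (col i x)).
Proof.
by move=> Ps; rewrite expect_prod; apply: eq_bigr => i _; rewrite expect_col.
Qed.

Lemma expect_mean s (j : 'I_r) (i : 'I_n) : prob_columns s ->
  expect s (fun x => x j i) = s j i.
Proof.
move=> Ps; transitivity (\sum_j' s j' i * (delta_mx j' 0 : 'cV[R]_r) j 0).
  rewrite -(expect_col i (fun v => v j 0) Ps).
  by apply: eq_bigr => w _; rewrite [in RHS]mxE.
rewrite (bigD1 j) //= mxE !eqxx mulr1 big1 ?addr0 // => j' ne.
by rewrite mxE [j == _]eq_sym (negPf ne) mulr0.
Qed.

Lemma law_sum1 s : prob_columns s -> \sum_(w : outcome) law s w = 1.
Proof.
move=> Ps; rewrite -(bigA_distr_bigA (fun i j => s j i)).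
by rewrite big1 // => i _; case: (Ps i).
Qed.

End Model.

Arguments pw_const_class : clear implicits.

(* Main.v *)
Require Import Defs.
From mathcomp Require Import all_boot all_order all_algebra.
From mathcomp Require Import boolp classical_sets reals constructive_ereal ereal.
From mathcomp Require Import exp.
From mathcomp Require Import sequences ring lra zify.

Import Order.TTheory GRing.Theory Num.Theory.
Local Open Scope ring_scope.

Set Implicit Arguments.
Unset Strict Implicit.
Unset Printing Implicit Defensive.

(** Both sides of the inequality are of order k (1 + ln (n / k)).

    Upper bound.  Write e for the noise matrix X - s and fix a partition m0
    on which the true mean s is constant.  Comparing the criterion at the
    selected partition m with its value at m0 gives
      |s - st|^2 <= 2 (pen m0 - pen m) + 4 Z,
    where Z, the energy of e on the common refinement of m and m0, is the sum
    over the cells I of |sum of the e_i, i in I|^2 / |I| (selected_loss_le).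
    The point is a deviation bound for Z that depends neither on r nor on the
    lengths of the cells: E exp (lam Z) <= exp (4 lam (number of cells)) for
    lam <= 1/64 (expect_exp_energy).  It is obtained by integrating out the
    columns one at a time; each integration inflates the coefficient of the
    squared norm of a partial sum only slightly (exp_sqnorm_step), and over a
    cell these inflations add up to a factor at most 2.  The supremum over m
    is handled by summing exponentials over all subsets A of 'I_n, viewed as
    sets of left ends of intervals, with weights
    exp (- |A| ln (n / |A|) - 3 |A|) whose sum is at most 2
    (sum_subset_weights).  The penalty pays for these weights as soon as
    c1 >= 128 and c2 >= 392 (EI_loss_le), and EI_risk_le follows.

    Lower bound.  Cut part of 'I_n into K = (k - 1) / 2 blocks, each made of
    M = 2 ^ l slots of l consecutive indices.  The mean is (1/2, 1/2, 0, ...)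
    everywhere except on one slot per block, where it is (3/4, 1/4, 0, ...).
    Such a mean has at most 2 K + 1 <= k pieces.  The loss is additive over
    blocks, so a uniform prior on the positions of the bumps reduces the
    problem to a single block.  There, locating the bump among M positions is
    a test between hypotheses whose second moment relative to the mean without
    bump in that block is (5/4)^l <= 5/8 M, which is too small for the test to
    succeed often (one_block_bound).  A wrong guess costs a constant times l,
    hence a risk of order K l, and l is chosen of order 1 + ln (n / K)
    (minimax_lower). *)

(** * Resampling one coordinate of a product law *)

Section Resampling.
Variables (A : comRingType) (I J : finType) (p : I -> J -> A).

Definition upd (T : Type) (w : {ffun I -> T}) (t : I) (j : T) : {ffun I -> T} :=
  [ffun i => if i == t then j else w i].

Lemma upd_same (T : Type) (w : {ffun I -> T}) t j : upd w t j t = j.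
Proof. by rewrite ffunE eqxx. Qed.

Lemma upd_other (T : Type) (w : {ffun I -> T}) t j i : i != t -> upd w t j i = w i.
Proof. by move=> /negPf it; rewrite ffunE it. Qed.

(** Redrawing the coordinate t from its own law, independently of the rest,
    does not change the distribution.  The swap of the old and the new value of
    the coordinate is an involution of the pairs (w, j) which preserves the
    product weight, so no factorization of the sum is needed.  With p constant,
    it averages over one coordinate of a uniform variable. *)
Lemma sum_resample (F : {ffun I -> J} -> A) (t : I) :
  \sum_(w : {ffun I -> J}) (\prod_i p i (w i)) * (\sum_j p t j * F (upd w t j)) =
  (\sum_j p t j) * \sum_(w : {ffun I -> J}) (\prod_i p i (w i)) * F w.
Proof.
rewrite mulr_sumr.
under eq_bigr do rewrite mulr_sumr.
under [RHS]eq_bigr do rewrite mulr_suml.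
rewrite !pair_bigA /=.
pose h (u : {ffun I -> J} * J) := (upd u.1 t u.2, u.1 t).
have hK : involutive h.
  case=> w j; rewrite /h /= upd_same; congr pair.
  by apply/ffunP => i; rewrite !ffunE; case: eqP => [->|].
rewrite [RHS](reindex_inj (inv_inj hK)) /=; apply: eq_bigr => -[w j] _ /=.
rewrite (bigD1 t) //= [X in _ = _ * (X * _)](bigD1 t) //= upd_same.
rewrite [X in _ = _ * (_ * X * _)](eq_bigr (fun i => p i (w i))); last first.
  by move=> i it; rewrite upd_other.
by ring.
Qed.

End Resampling.

(** * Exponential moments of the noise energy *)

Section ExponentialMoments.
Variable R : realType.

(** For a centred variable Y the linear term disappears on taking expectations,
    so this bounds E exp Y by E exp (2 Y^2), whatever the range of Y. *)
Lemma expR_le_add_expR_sqr (y : R) : expR y <= y + expR (2 * y ^+ 2).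
Proof.
have H := expR_ge1Dx (2 * y ^+ 2).
have [y1|y1] := lerP 1 y.
  apply: (@le_trans _ _ (expR (2 * y ^+ 2))); last by lra.
  by rewrite ler_expR; nra.
suff : expR y <= 1 + y + 2 * y ^+ 2 by lra.
have [y0|y0] := lerP y 0.
  have := expR_ge1Dx (- y); rewrite expRN => Hy.
  have P := expR_gt0 y.
  have : expR y * (1 - y) <= 1.
    rewrite -[leRHS](mulfV (lt0r_neq0 P)).
    by apply: ler_wpM2l => //; apply: ltW.
  by nra.
(* For y in (0, 1), square exp (y / 2) (1 - y / 2) <= 1; the same bound without
   halving y would be too weak near 1. *)
have := expR_ge1Dx (- (y / 2)); rewrite expRN => Hy.
have P := expR_gt0 (y / 2).
have E : expR y = expR (y / 2) ^+ 2 by rewrite expr2 -expRD; congr expR; lra.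
have : expR (y / 2) * (1 - y / 2) <= 1.
  rewrite -[leRHS](mulfV (lt0r_neq0 P)).
  by apply: ler_wpM2l => //; apply: ltW.
move=> Q.
have Q2 : expR y * (1 - y / 2) ^+ 2 <= 1.
  by rewrite E -exprMn expr_le1 //; apply: mulr_ge0; lra.
have : (1 - y / 2) ^+ 2 * expR y <= (1 - y / 2) ^+ 2 * (1 + y + 2 * y ^+ 2).
  rewrite mulrC (le_trans Q2) //.
  suff : 0 <= y ^+ 2 * ((1 - y) * (5 - 2 * y)) by lra.
  by rewrite mulr_ge0 ?sqr_ge0 // mulr_ge0; lra.
by rewrite ler_pM2l // exprn_gt0 //; lra.
Qed.

Lemma cauchy_schwarz_sum (I : finType) (u v : I -> R) :
  (\sum_i u i * v i) ^+ 2 <= (\sum_i u i ^+ 2) * (\sum_i v i ^+ 2).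
Proof.
pose U := \sum_i u i ^+ 2; pose V := \sum_i v i ^+ 2; pose P := \sum_i u i * v i.
have V0 : 0 <= V by apply: sumr_ge0 => i _; apply: sqr_ge0.
(* Expand the square of the component of u orthogonal to v. *)
have key : 0 <= V * (V * U - P ^+ 2).
  have -> : V * (V * U - P ^+ 2) = \sum_i (V * u i - P * v i) ^+ 2.
    transitivity (\sum_i (V ^+ 2 * u i ^+ 2 - (2 * V * P) * (u i * v i)
                          + P ^+ 2 * v i ^+ 2)); last first.
      by apply: eq_bigr => i _; ring.
    rewrite big_split /= sumrB -!mulr_sumr -/U -/V -/P; ring.
  by apply: sumr_ge0 => i _; apply: sqr_ge0.
rewrite -/U -/V -/P.
have [Vz|Vnz] := eqVneq V 0.
  suff -> : P = 0 by rewrite Vz mulr0 expr0n.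
  have vz i : v i = 0.
    apply/eqP; rewrite -sqrf_eq0; apply/eqP.
    by apply: (psumr_eq0P _ Vz) => // k _; apply: sqr_ge0.
  by apply: big1 => i _; rewrite vz mulr0.
have Vp : 0 < V by rewrite lt_neqAle eq_sym Vnz.
by move: key; rewrite pmulr_rge0 // subr_ge0 mulrC.
Qed.

(** If e is the centred indicator vector of a variable of law p, then
    |v + e|^2 = |v|^2 + 2 <v, e> + |e|^2 with |e|^2 <= 2, while Y = 2 a <v, e>
    is centred and 2 Y^2 <= 16 a^2 |v|^2.  The number r of coordinates enters
    neither bound, which is what makes the final constants independent of r. *)
Lemma exp_sqnorm_step (r : nat) (p v : 'I_r -> R) (a : R) :
  (forall j, 0 <= p j) -> \sum_j p j = 1 -> 0 <= a ->
  \sum_j p j * expR (a * \sum_c (v c + ((j == c)%:R - p c)) ^+ 2) <=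
  expR ((a + 16 * a ^+ 2) * (\sum_c v c ^+ 2) + 2 * a).
Proof.
move=> p0 p1 a0; set V := \sum_c v c ^+ 2.
have V0 : 0 <= V by apply: sumr_ge0 => i _; apply: sqr_ge0.
have ple c : p c <= 1.
  by rewrite -p1 (bigD1 c) //= lerDl; apply: sumr_ge0.
pose e j c : R := (j == c)%:R - p c.
pose y j := 2 * a * \sum_c v c * e j c.
have e2 j : \sum_c e j c ^+ 2 <= 2.
  apply: (@le_trans _ _ (\sum_c ((j == c)%:R + p c))); last first.
    rewrite big_split /= p1 (bigD1 j) //= eqxx big1 => [|c]; first by rewrite addr0.
    by rewrite eq_sym => /negPf ->.
  apply: ler_sum => c _; rewrite /e.
  by have := p0 c; have := ple c; case: (j == c) => /=; nra.
have ysum : \sum_j p j * y j = 0.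
  rewrite /y; under eq_bigr do rewrite mulrCA mulr_sumr.
  rewrite -mulr_sumr exchange_big /= big1 ?mulr0 // => c _.
  transitivity (v c * \sum_j (p j * (j == c)%:R - p j * p c)).
    by rewrite mulr_sumr; apply: eq_bigr => j _; rewrite /e; ring.
  rewrite sumrB -mulr_suml p1 (bigD1 c) //= eqxx big1 => [|j /negPf ->]; last by rewrite mulr0.
  by rewrite mulr1 addr0 mul1r subrr mulr0.
have ysq j : 2 * y j ^+ 2 <= 16 * a ^+ 2 * V.
  have CS := cauchy_schwarz_sum v (e j).
  have VE : V * (\sum_c e j c ^+ 2) <= V * 2 by apply: ler_wpM2l.
  have : a ^+ 2 * (\sum_c v c * e j c) ^+ 2 <= a ^+ 2 * (V * 2).
    by apply: ler_wpM2l; [apply: sqr_ge0 | apply: le_trans VE].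
  by rewrite /y !exprMn -/V; lra.
have step j : expR (a * \sum_c (v c + e j c) ^+ 2) <=
    expR (a * V + 2 * a) * (y j + expR (16 * a ^+ 2 * V)).
  have -> : \sum_c (v c + e j c) ^+ 2
            = V + 2 * (\sum_c v c * e j c) + \sum_c e j c ^+ 2.
    rewrite /V mulr_sumr -!big_split /=; apply: eq_bigr => c _; ring.
  apply: (@le_trans _ _ (expR (a * V + 2 * a) * expR (y j))).
    rewrite -expRD ler_expR /y.
    have : a * \sum_c e j c ^+ 2 <= a * 2 by apply: ler_wpM2l.
    by lra.
  rewrite ler_wpM2l ?expR_ge0 // (le_trans (expR_le_add_expR_sqr _)) //.
  by rewrite lerD2l ler_expR.
apply: (@le_trans _ _
    (\sum_j p j * (expR (a * V + 2 * a) * (y j + expR (16 * a ^+ 2 * V))))).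
  by apply: ler_sum => j _; apply: ler_wpM2l; [exact: p0 | exact: step].
under eq_bigr do rewrite mulrCA mulrDr.
rewrite -mulr_sumr big_split /= ysum -mulr_suml p1 add0r mul1r -expRD ler_expR.
by lra.
Qed.

End ExponentialMoments.

Section CellEnergy.
Variables (R : realType) (r n : nat) (L : finType) (c : 'I_n -> L).

Definition cell_card (y : L) : nat := #|[set i | c i == y]|.

(** The squared norm of the orthogonal projection of e onto the matrices that
    are constant on the fibres of c.  An empty fibre contributes 0 / 0 = 0. *)
Definition cell_energy (e : 'M[R]_(r, n)) : R :=
  \sum_y (\sum_j (\sum_(i | c i == y) e j i) ^+ 2) / (cell_card y)%:R.

(** Cellwise 2 <V, t> <= 2 |V|^2 / N + N |t|^2 / 2, where V is the sum of e
    over a cell of N indices and t is constant on it. *)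
Lemma cell_pairing_le (e t : 'M[R]_(r, n)) :
  (forall i i', c i = c i' -> forall j, t j i = t j i') ->
  2 * inner e t <= 2 * cell_energy e + 2^-1 * inner t t.
Proof.
move=> tc.
have regroup (F : 'I_n -> R) : \sum_i F i = \sum_y \sum_(i | c i == y) F i.
  by rewrite (partition_big c xpredT).
rewrite /inner !(regroup (fun i => \sum_j _)) /cell_energy !mulr_sumr -big_split /=.
apply: ler_sum => y _.
have [N0|[i0 i0y]] := finset.set_0Vmem [set i | c i == y].
  have nc i : (c i == y) = false.
    by apply/negbTE/negP => ciy; move/setP/(_ i): N0; rewrite !inE ciy.
  rewrite !(eq_bigl _ _ nc) !big_pred0_eq !mulr0 addr0 mulr_ge0 //.
  by rewrite divr_ge0 // sumr_ge0 // => j _; apply: sqr_ge0.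
rewrite inE in i0y; set N := (cell_card y)%:R.
have N0 : 0 < N :> R.
  by rewrite ltr0n; apply/card_gt0P; exists i0; rewrite inE.
have swap (F : 'I_n -> 'I_r -> R) :
  \sum_(i | c i == y) \sum_j F i j = \sum_j \sum_(i | c i == y) F i j.
  exact: exchange_big.
rewrite !swap mulr_suml !mulr_sumr -big_split /=.
apply: ler_sum => j _.
have tE i : c i == y -> t j i = t j i0.
  by move=> /eqP ciy; apply: tc; rewrite ciy (eqP i0y).
rewrite (eq_bigr (fun i => e j i * t j i0)); last by move=> i /tE ->.
rewrite [X in _ <= _ + _ * X](eq_bigr (fun i => t j i0 ^+ 2)); last by move=> i /tE ->.
rewrite sumr_const -mulr_suml.
have -> : #|[pred i | c i == y]| = cell_card y by rewrite /cell_card cardsE.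
set V := \sum_(i | _) e j i; rewrite -[t j i0 ^+ 2 *+ _]mulr_natr -/N.
have : 0 <= (2 * V - N * t j i0) ^+ 2 / N by rewrite divr_ge0 ?sqr_ge0 // ltW.
suff -> : (2 * V - N * t j i0) ^+ 2 / N
   = 4 * (V ^+ 2 / N) - 4 * (V * t j i0) + t j i0 ^+ 2 * N by lra.
by field; rewrite gt_eqF.
Qed.

End CellEnergy.

Section EnergyMoment.
Variables (R : realType) (r n : nat) (s : 'M[R]_(r, n)).
Hypothesis s_prob : prob_columns s.
Variables (L : finType) (c : 'I_n -> L) (lam : R).
Hypothesis lam_bounds : 0 <= lam <= 64^-1.

Let N (y : L) : R := (cell_card c y)%:R.
Let rem (y : L) (t : nat) : R := #|[set i | (c i == y) && (t <= i)%N]|%:R.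
Let alpha (y : L) (t : nat) : R := lam / N y * (1 + rem y t / N y).
Let V (y : L) (t : nat) (w : outcome r n) (j : 'I_r) : R :=
  \sum_(i | (c i == y) && (i < t)%N) ((w i == j)%:R - s j i).
Let term (y : L) (t : nat) (w : outcome r n) : R :=
  alpha y t * (\sum_j V y t w j ^+ 2) + 4 * lam * (rem y t / N y).
(** The exponent of a supermartingale: at t = 0 it is deterministic, and at
    t = n it is lam times the energy.  Each index of a
    cell of size N still to be revealed adds lam / N^2 to the coefficient alpha
    of the squared partial sum and 4 lam / N to the constant term, so alpha
    stays between lam / N and 2 lam / N. *)
Let Phi (t : nat) (w : outcome r n) : R := \sum_y term y t w.

Let law_ge0 w : 0 <= law s w.
Proof. by apply: prodr_ge0 => i _; case: (s_prob i) => ->. Qed.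

(** Resampling the column t affects only the cell of t; the change of alpha and
    of the constant there absorbs the loss in exp_sqnorm_step. *)
Lemma energy_supermartingale (t : 'I_n) :
  \sum_w law s w * expR (Phi t.+1 w) <= \sum_w law s w * expR (Phi t w).
Proof.
case: (s_prob t) => s0 s1.
have := sum_resample (fun i j => s j i) (fun w => expR (Phi t.+1 w)) t.
rewrite s1 mul1r => <-; apply: ler_sum => w _; apply: ler_wpM2l; first exact: law_ge0.
rewrite {2}/Phi (bigD1 (c t)) //= expRD mulrC.
set rest := \sum_(y | y != c t) _.
have restE j : Phi t.+1 (upd w t j) = rest + term (c t) t.+1 (upd w t j).
  rewrite /Phi (bigD1 (c t)) //= addrC; congr (_ + _).
  apply: eq_bigr => y yct.
  have ne i : (c i == y) -> i != t by apply: contraTneq => ->; rewrite eq_sym.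
  have ltE i : (c i == y) && (i < t.+1)%N = (c i == y) && (i < t)%N.
    case ciy: (c i == y) => //=; rewrite ltnS leq_eqVlt.
    by have /negPf := ne _ ciy; rewrite -val_eqE => ->.
  have remE : rem y t.+1 = rem y t.
    rewrite /rem; congr (_%:R); apply: eq_card => i; rewrite !inE.
    case ciy: (c i == y) => //=; rewrite [RHS]leq_eqVlt.
    by have /negPf := ne _ ciy; rewrite -val_eqE eq_sym => ->.
  rewrite /term /alpha remE; congr (_ * _ + _); apply: eq_bigr => k _.
  congr (_ ^+ 2); rewrite /V (eq_bigl _ _ ltE); apply: eq_bigr => i /andP[ciy _].
  by rewrite upd_other // ne.
under eq_bigr do rewrite restE expRD mulrCA.
rewrite -mulr_sumr ler_wpM2l ?expR_ge0 //.
set y := c t.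
have VE j k : V y t.+1 (upd w t j) k = V y t w k + ((j == k)%:R - s k t).
  rewrite /V (bigD1 t) /= ?eqxx ?ltnSn // upd_same addrC; congr (_ + _).
  apply: eq_big => [i|i /andP[_ it]]; last by rewrite upd_other.
  rewrite ltnS [(i <= t)%N]leq_eqVlt -val_eqE /= -andbA.
  by case: (c i == y) => //=; case: ltngtP.
have remE : rem y t = rem y t.+1 + 1.
  rewrite /rem [in LHS](cardD1 t) !inE eqxx leqnn /= addrC natrD; congr (_ + _%:R).
  apply: eq_card => i; rewrite !inE -val_eqE /=.
  by case: (c i == y); rewrite ?andbF //=; case: ltngtP.
have N0 : 0 < N y.
  by rewrite ltr0n; apply/card_gt0P; exists t; rewrite inE.
have remN : rem y t.+1 <= N y.
  rewrite ler_nat; apply: subset_leq_card; apply/fintype.subsetP => i.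
  by rewrite !inE => /andP[].
have rem0 : 0 <= rem y t.+1 by rewrite ler0n.
case/andP: lam_bounds => l0 l1.
have lN : 0 <= lam / N y by rewrite divr_ge0 // ltW.
have q0 : 0 <= rem y t.+1 / N y by rewrite divr_ge0 // ltW.
have q1 : rem y t.+1 / N y <= 1 by rewrite ler_pdivrMr // mul1r.
have a0 : 0 <= alpha y t.+1 by rewrite mulr_ge0 // addr_ge0.
have a1 : alpha y t.+1 <= 2 * (lam / N y).
  by rewrite /alpha mulrC ler_wpM2r //; lra.
have aE : alpha y t = alpha y t.+1 + lam / N y / N y.
  by rewrite /alpha remE; field; rewrite gt_eqF.
(* This is where 64 lam <= 1 is used, with alpha <= 2 lam / N. *)
have a2 : 16 * alpha y t.+1 ^+ 2 <= lam / N y / N y.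
  have : alpha y t.+1 ^+ 2 <= (2 * (lam / N y)) ^+ 2.
    by rewrite !expr2; apply: ler_pM.
  suff : 16 * (2 * (lam / N y)) ^+ 2 <= lam / N y / N y by lra.
  have -> : 16 * (2 * (lam / N y)) ^+ 2 = 64 * lam * (lam / N y / N y).
    by field; rewrite gt_eqF.
  rewrite ler_piMl ?divr_ge0 ?(ltW N0) //; lra.
have bE : 4 * lam * (rem y t / N y) = 4 * lam * (rem y t.+1 / N y) + 4 * (lam / N y).
  by rewrite remE; field; rewrite gt_eqF.
rewrite /term.
have tE j : \sum_k V y t.+1 (upd w t j) k ^+ 2
          = \sum_k (V y t w k + ((j == k)%:R - s k t)) ^+ 2.
  by apply: eq_bigr => k _; rewrite VE.
under eq_bigr do rewrite tE expRD [s _ t * _]mulrA.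
rewrite -mulr_suml.
apply: le_trans (_ : expR _ * _ <= _).
  by apply: ler_wpM2r; [exact: expR_ge0 | exact: (exp_sqnorm_step _ s0 s1 a0)].
rewrite -expRD ler_expR bE.
set W := \sum_k _.
have W0 : 0 <= W by apply: sumr_ge0 => k _; apply: sqr_ge0.
have : (alpha y t.+1 + 16 * alpha y t.+1 ^+ 2) * W <= alpha y t * W.
  by apply: ler_wpM2r => //; rewrite aE; lra.
by lra.
Qed.

(** Only the nonempty cells contribute to the initial exponent, each of them
    exactly 4 lam. *)
Lemma expect_exp_energy :
  expect s (fun x => expR (lam * cell_energy c (x - s))) <=
  expR (4 * lam * #|[set c i | i : 'I_n]|%:R).
Proof.
have mono t : (t <= n)%N ->
  \sum_w law s w * expR (Phi t w) <= \sum_w law s w * expR (Phi 0 w).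
  elim: t => [//|t IH] tn; apply: le_trans (IH (ltnW tn)).
  exact: (energy_supermartingale (Ordinal tn)).
have rem_n y : rem y n = 0.
  rewrite /rem (_ : [set _ | _] = finset.set0) ?cards0 //.
  by apply/setP => i; rewrite !inE leqNgt ltn_ord andbF.
have rem_0 y : rem y 0 = N y.
  by rewrite /rem /N /cell_card; congr (_%:R); apply: eq_card => i; rewrite !inE andbT.
apply: le_trans (_ : \sum_w law s w * expR (Phi n w) <= _).
  apply: ler_sum => w _; apply: ler_wpM2l; first exact: law_ge0.
  rewrite ler_expR /cell_energy mulr_sumr; apply: ler_sum => y _.
  rewrite /term /alpha rem_n mul0r addr0 mulr0 addr0 mulr1.
  rewrite -[lam / _ * _]mulrA [(N y)^-1 * _]mulrC le_eqVlt; apply/orP; left.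
  apply/eqP; congr (_ * (_ / _)); apply: eq_bigr => j _; congr (_ ^+ 2).
  by apply: eq_big => [i|i _]; rewrite ?ltn_ord ?andbT // !mxE.
apply: le_trans (mono n (leqnn n)) _.
have PhiE w : Phi 0 w = 4 * lam * #|[set c i | i : 'I_n]|%:R.
  rewrite /Phi -sum1_card natr_sum mulr_sumr [RHS]big_mkcond /=.
  apply: eq_bigr => y _; rewrite /term big1 ?mulr0 ?add0r => [|j _]; last first.
    by rewrite /V big1 ?expr0n // => i /andP[].
  rewrite rem_0; case: ifP => [/imsetP[i _ yi]|ny].
    by rewrite divff // gt_eqF // ltr0n; apply/card_gt0P; exists i; rewrite inE yi.
  rewrite (_ : N y = 0) ?mul0r ?mulr0 //.
  apply/eqP; rewrite pnatr_eq0 cards_eq0; apply/eqP/setP => i; rewrite !inE.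
  by apply/negbTE/negP => /eqP ciy; rewrite -ciy imset_f in ny.
under eq_bigr do rewrite PhiE.
by rewrite -mulr_suml law_sum1 // mul1r.
Qed.

End EnergyMoment.

(** * Interval partitions and their left ends *)

Section SubsetWeights.
Variable R : realType.

(** The left side is C(n, D) x^D with x = D / n, a term of the binomial
    expansion of (1 + x)^n <= exp (n x) = exp D. *)
Lemma bin_mul_exp_le (n D : nat) : (D <= n)%N ->
  'C(n, D)%:R * expR (- (D%:R * ln (n%:R / D%:R))) <= expR D%:R :> R.
Proof.
case: D => [|D] Dn; first by rewrite bin0 mul0r oppr0 expR0 mulr1.
have n0 : 0 < n%:R :> R by rewrite ltr0n; apply: leq_trans Dn.
have D0 : 0 < D.+1%:R :> R by rewrite ltr0n.
pose x : R := D.+1%:R / n%:R.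
have x0 : 0 < x by rewrite divr_gt0.
have -> : expR (- (D.+1%:R * ln (n%:R / D.+1%:R))) = x ^+ D.+1.
  rewrite -mulrN expRM_natl expRN lnK ?posrE ?divr_gt0 //.
  by rewrite invf_div.
apply: (@le_trans _ _ ((1 + x) ^+ n)).
  rewrite exprDn (bigD1 (Ordinal (Dn : (D.+1 < n.+1)%N))) //=.
  rewrite expr1n mul1r mulr_natl lerDl.
  by apply: sumr_ge0 => i _; rewrite mulrn_wge0 // expr1n mul1r exprn_ge0 // ltW.
have -> : expR D.+1%:R = expR x ^+ n.
  by rewrite -expRM_natr; congr expR; rewrite divfK // gt_eqF.
apply: lerXn2r (expR_ge1Dx x); rewrite nnegrE ?expR_ge0 //.
by rewrite addr_ge0 // ltW.
Qed.

(** There are C(n, D) subsets of size D, so the previous bound leaves the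
    geometric series of exp (- 2 D) <= 2 ^- D. *)
Lemma sum_subset_weights (n : nat) :
  \sum_(A : {set 'I_n})
    expR (- (#|A|%:R * ln (n%:R / #|A|%:R) + 3 * #|A|%:R)) <= 2 :> R.
Proof.
pose f D : R := expR (- (D%:R * ln (n%:R / D%:R) + 3 * D%:R)).
have cle (A : {set 'I_n}) : (#|A| < n.+1)%N by rewrite ltnS -[leqRHS]card_ord max_card.
rewrite (partition_big (fun A : {set 'I_n} => Ordinal (cle A)) xpredT) //=.
apply: (@le_trans _ _ (\sum_(D < n.+1) 2^-1 ^+ D)).
  apply: ler_sum => D _.
  rewrite (eq_bigr (fun=> f D)); last by move=> A /eqP <-.
  rewrite sumr_const.
  have -> : #|[pred A : {set 'I_n} | Ordinal (cle A) == D]| = 'C(n, D).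
    transitivity 'C(#|'I_n|, D); last by rewrite card_ord.
    by rewrite -card_draws; apply: eq_card => A; rewrite !inE -val_eqE.
  rewrite -[f D *+ _]mulr_natl /f opprD expRD mulrA.
  have Dn : (D <= n)%N by rewrite -ltnS.
  apply: (@le_trans _ _ (expR D%:R * expR (- (3 * D%:R)))).
    by rewrite ler_wpM2r ?expR_ge0 // bin_mul_exp_le.
  rewrite -expRD.
  have -> : D%:R - 3 * D%:R = D%:R * -2 :> R by ring.
  rewrite expRM_natl; apply: lerXn2r; rewrite ?nnegrE ?expR_ge0 ?invr_ge0 //.
  rewrite expRN lef_pV2 ?posrE ?expR_gt0 //.
  by apply: le_trans (expR_ge1Dx 2); lra.
have geo m : \sum_(D < m) 2^-1 ^+ D = 2 - 2 * 2^-1 ^+ m :> R.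
  elim: m => [|m IH]; first by rewrite big_ord0 expr0 mulr1 subrr.
  by rewrite big_ord_recr /= IH exprS; lra.
by rewrite geo lerBlDr lerDl mulr_ge0 // exprn_ge0 // invr_ge0.
Qed.

End SubsetWeights.

Section Breakpoints.
Variable n : nat.
Implicit Types (B : {set 'I_n}) (m : {set {set 'I_n}}).

(** The intervals cut by B, the elements of B starting new intervals, are the
    fibres of this counting function. *)
Definition piece B (i : 'I_n) : 'I_(#|B|.+1) :=
  inord #|[set a in B | (a <= i)%N]|.

Lemma val_piece B i : piece B i = #|[set a in B | (a <= i)%N]| :> nat.
Proof.
rewrite inordK // ltnS; apply: subset_leq_card.
by apply/fintype.subsetP => a; rewrite inE => /andP[].
Qed.

Lemma eq_piece B (i i' : 'I_n) : (i <= i')%N ->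
  piece B i = piece B i' <-> (forall a : 'I_n, a \in B -> (i < a <= i')%N -> False).
Proof.
move=> ii'.
have sub : [set a in B | (a <= i)%N] \subset [set a in B | (a <= i')%N].
  apply/fintype.subsetP => a; rewrite !inE => /andP[-> ai] /=.
  exact: leq_trans ii'.
split=> [eqp a aB /andP[ia ai']|none].
  have /eqP eqs : [set a in B | (a <= i)%N] == [set a in B | (a <= i')%N].
    by rewrite eqEcard sub /= -!val_piece eqp.
  by move/setP/(_ a): eqs; rewrite !inE aB ai' leqNgt ia.
apply: val_inj; rewrite /= !val_piece; apply: eq_card => a; rewrite !inE.
case aB: (a \in B) => //=; apply/idP/idP => [ai|ai']; first exact: leq_trans ii'.
by rewrite leqNgt; apply/negP => ia; apply: (none a aB); rewrite ia.
Qed.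

(** Least elements of the blocks.  They turn an interval partition into a plain
    subset of 'I_n, for which refinement becomes inclusion and counting is
    binomial. *)
Definition left_ends m : {set 'I_n} :=
  [set i | [forall i', (i' \in finset.pblock m i) ==> (i <= i')%N]].

Lemma interval_partition_cover m i :
  m \in interval_partitions n -> i \in finset.cover m.
Proof. by rewrite inE => /andP[/and3P[/eqP -> _ _] _]; rewrite inE. Qed.

Lemma interval_partition_triv m : m \in interval_partitions n -> finset.trivIset m.
Proof. by rewrite inE => /andP[/and3P[]]. Qed.

Lemma eq_pblockE m (i i' : 'I_n) : m \in interval_partitions n ->
  (i' \in finset.pblock m i) = (finset.pblock m i == finset.pblock m i').
Proof.
move=> mP; rewrite finset.eq_pblock //; first exact: interval_partition_triv.
exact: interval_partition_cover.
Qed.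

Lemma block_left_end m (i : 'I_n) : m \in interval_partitions n ->
  exists a, [/\ a \in left_ends m, (a <= i)%N & finset.pblock m a = finset.pblock m i].
Proof.
move=> mP.
have ii : i \in finset.pblock m i by rewrite eq_pblockE.
case: (arg_minnP (fun a : 'I_n => a : nat) ii) => a ai amin.
have E : finset.pblock m a = finset.pblock m i by apply/esym/eqP; rewrite -eq_pblockE.
exists a; split => //; last exact: amin.
by rewrite inE; apply/forallP => b; apply/implyP; rewrite E; apply: amin.
Qed.

Lemma card_left_ends m : m \in interval_partitions n -> #|left_ends m| = #|m|.
Proof.
move=> mP; rewrite -(@card_in_imset _ _ (finset.pblock m) (left_ends m)).
  apply: eq_card => J; apply/imsetP/idP => [[i _ ->]|Jm].
    exact/finset.pblock_mem/interval_partition_cover.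
  have /set0Pn [i iJ] : J != finset.set0.
    by apply: contraTneq Jm => ->; move: mP; rewrite inE => /andP[/and3P[]].
  have [a [aL _ aE]] := block_left_end i mP; exists a => //.
  by rewrite aE (finset.def_pblock (interval_partition_triv mP) Jm iJ).
move=> i i'; rewrite !inE => /forallP Hi /forallP Hi' E; apply: val_inj.
apply/eqP; rewrite /= eqn_leq.
have := Hi i'; have := Hi' i; rewrite !eq_pblockE // E eqxx /= => -> ->.
by [].
Qed.

(** The least element of the block of i' cannot lie in (i, i'], since the pieces
    of i and i' agree; so it is at most i, and i lies between two elements of an
    interval. *)
Lemma eq_piece_pblock m B (i i' : 'I_n) : m \in interval_partitions n ->
  left_ends m \subset B -> piece B i = piece B i' -> finset.pblock m i = finset.pblock m i'.
Proof.
move=> mP sB; wlog ii' : i i' / (i <= i')%N.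
  by move=> W; case/orP: (leq_total i i') => [|/W H /esym /H]; [exact: W|].
move/(eq_piece _ ii') => none.
have [a [aL ai' aE]] := block_left_end i' mP.
have {none} ai : (a <= i)%N.
  by rewrite leqNgt; apply/negP => ia; apply: (none a); rewrite ?ia // (fintype.subsetP sB).
have Jm : finset.pblock m i' \in m by apply/finset.pblock_mem/interval_partition_cover.
have : is_interval (finset.pblock m i').
  by move: mP; rewrite inE => /andP[_ /forallP/(_ (finset.pblock m i'))]; rewrite Jm.
move/forallP/(_ a); rewrite eq_pblockE // -aE eqxx /= => /forallP/(_ i').
rewrite eq_pblockE // aE eqxx /= => /forallP/(_ i); rewrite ai ii' /=.
by rewrite eq_pblockE // => /eqP.
Qed.

(** The inverse construction, which produces a partition with a prescribed
    number of blocks. *)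
Definition pieces B : {set {set 'I_n}} := preim_partition (piece B) [set: 'I_n].

Lemma pieces_interval B : pieces B \in interval_partitions n.
Proof.
rewrite inE preim_partitionP /=.
apply/forallP => J; apply/implyP => /imsetP [i _ ->].
apply/forallP => a; apply/implyP; rewrite !inE => /eqP aE.
apply/forallP => b; apply/implyP; rewrite !inE => /eqP bE.
apply/forallP => x; apply/implyP => /andP[ax xb]; rewrite !inE /=; apply/eqP.
rewrite aE; have := bE; rewrite aE => /(eq_piece _ (leq_trans ax xb)) none.
apply/(eq_piece _ ax) => z zB /andP[az zx]; apply: (none z zB).
by rewrite az (leq_trans zx).
Qed.

(** Each piece has a greatest element of B below it, its left end, provided that
    the first index belongs to B. *)
Lemma card_pieces B (n0 : (0 < n)%N) : Ordinal n0 \in B -> #|pieces B| = #|B|.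
Proof.
move=> B0; set cl := fun a : 'I_n => [set i in [set: 'I_n] | piece B a == piece B i].
rewrite -(@card_in_imset _ _ cl B).
  apply: eq_card => J; apply/imsetP/imsetP => [[i _ ->]|[i _ ->]]; last by exists i.
  have P0 : [pred a : 'I_n | (a \in B) && (a <= i)%N] (Ordinal n0) by rewrite /= B0.
  case: (arg_maxnP (fun a : 'I_n => a : nat) P0) => a /= /andP[aB ai] amax.
  exists a => //; apply/setP => x; rewrite !inE /=; congr (_ == _).
  apply/esym/(eq_piece _ ai) => z zB /andP[az zi].
  by have := amax z; rewrite zB zi /= => /(_ isT); rewrite leqNgt az.
move=> a b aB bB E.
have {E} E : piece B a = piece B b.
  by move/setP/(_ b): E; rewrite !inE eqxx /= => /eqP.
have lt x y : x \in B -> y \in B -> (x < y)%N -> piece B x = piece B y -> False.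
  by move=> _ yB xy /(eq_piece _ (ltnW xy)) /(_ y yB); rewrite xy leqnn => /(_ isT).
apply: val_inj; case: (ltngtP a b) => // ab.
  by case: (lt a b).
by case: (lt b a).
Qed.

Lemma eq_pblock_pieces B (i i' : 'I_n) :
  finset.pblock (pieces B) i = finset.pblock (pieces B) i' -> piece B i = piece B i'.
Proof.
move=> E; have : i' \in finset.pblock (pieces B) i.
  by rewrite eq_pblockE ?pieces_interval // E.
rewrite finset.pblock_equivalence_partition ?inE //; first by move/eqP.
by move=> x y z _ _ _ /=; split => // /eqP ->.
Qed.

End Breakpoints.

(** * Histogram spaces and the penalized projection *)

Section InnerProduct.
Variables (R : realType) (r n : nat).
Implicit Types (x s t u : 'M[R]_(r, n)).

Lemma innerC t u : inner t u = inner u t.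
Proof. by apply: eq_bigr => i _; apply: eq_bigr => j _; rewrite mulrC. Qed.

Lemma innerBl t u x : inner (t - u) x = inner t x - inner u x.
Proof.
rewrite /inner -sumrB; apply: eq_bigr => i _; rewrite -sumrB.
by apply: eq_bigr => j _; rewrite !mxE mulrBl.
Qed.

Lemma innerBr t u x : inner x (t - u) = inner x t - inner x u.
Proof. by rewrite !(innerC x) innerBl. Qed.

Lemma inner_ge0 t : 0 <= inner t t.
Proof. by do 2!apply: sumr_ge0 => ? _; rewrite -expr2 sqr_ge0. Qed.

Lemma norm2_sqr t : norm2 t ^+ 2 = inner t t.
Proof. by rewrite sqr_sqrtr ?inner_ge0. Qed.

Lemma contrast_orthproj_le (S : {vspace 'rV[R]_n}) x p t :
  is_orthproj S x p -> in_tensor S t -> contrast x p <= contrast x t.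
Proof.
move=> [pS xp] tS; rewrite /contrast !norm2_sqr.
have := xp _ pS; have := xp _ tS; rewrite !innerBl => e1 e2.
have := inner_ge0 (t - p); rewrite !(innerBl, innerBr) (innerC t p).
by lra.
Qed.

End InnerProduct.

Section HistogramSpace.
Variables (R : realType) (r n : nat) (m : {set {set 'I_n}}).
Hypothesis mP : m \in interval_partitions n.

Lemma mem_block (i i' : 'I_n) :
  (i' \in finset.pblock m i) = (finset.pblock m i' == finset.pblock m i).
Proof. by rewrite eq_pblockE // eq_sym. Qed.

Lemma block_of_mem (J : {set 'I_n}) i : J \in m -> i \in J -> finset.pblock m i = J.
Proof. exact/finset.def_pblock/interval_partition_triv. Qed.

Lemma dim_hist_space : \dim (hist_space R m) = #|m|.
Proof.
suff : free [seq psi R J | J <- enum m] by rewrite /free size_map -cardE => /eqP.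
apply/(@freeP _ _ _ (in_tuple _)) => a a0 i.
have szE : size [seq psi R J | J <- enum m] = size (enum m) by rewrite size_map.
pose J (k : 'I_(size [seq psi R J | J <- enum m])) := nth finset.set0 (enum m) k.
have Jm k : J k \in m by rewrite -mem_enum mem_nth // -szE.
have /set0Pn [x xJ] : J i != finset.set0.
  by apply: contraTneq (Jm i) => ->; move: mP; rewrite inE => /andP[/and3P[]].
move/rowP/(_ x): a0; rewrite summxE mxE (bigD1 i) //= big1 ?addr0 => [|k ki].
  by rewrite (nth_map finset.set0) -?szE // !mxE xJ mulr1.
rewrite (nth_map finset.set0) -?szE // !mxE.
case xk : (x \in _); last by rewrite mulr0.
case/negP: ki; rewrite -val_eqE /= -(nth_uniq finset.set0 _ _ (enum_uniq m)) -?szE //.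
apply/eqP; transitivity (finset.pblock m x).
  exact/esym/(block_of_mem (Jm k)).
exact: (block_of_mem (Jm i)).
Qed.

(** Conversely, a function constant on blocks is the sum over i of t_i psi_I / |I|
    with I the block of i, which avoids choosing a point in each block. *)
Lemma in_tensor_hist (t : 'M[R]_(r, n)) :
  in_tensor (hist_space R m) t <->
  (forall i i', finset.pblock m i = finset.pblock m i' -> forall j, t j i = t j i').
Proof.
split=> [tS i i' ii' j|tc j].
  have := tS j; set X := [seq psi R J | J <- enum m].
  move=> /(@coord_span _ _ _ (in_tuple X)) /rowP E.
  have := E i; have := E i'; rewrite !summxE !mxE => -> ->.
  apply: eq_bigr => k _; rewrite !mxE; congr (_ * _).
  have kX : (k < size (enum m))%N by rewrite -(size_map (@psi R n)) ltn_ord.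
  rewrite (nth_map finset.set0) // !mxE; congr (_%:R : R); congr nat_of_bool.
  have Jm : nth finset.set0 (enum m) k \in m by rewrite -mem_enum mem_nth.
  apply/idP/idP => [iJ|iJ].
    by rewrite -(block_of_mem Jm iJ) mem_block ii'.
  by rewrite -(block_of_mem Jm iJ) mem_block ii'.
have -> : row j t = \sum_i (t j i / #|finset.pblock m i|%:R) *: psi R (finset.pblock m i).
  apply/rowP => i0; rewrite summxE mxE.
  transitivity (\sum_(i in finset.pblock m i0) t j i0 / #|finset.pblock m i0|%:R).
    rewrite sumr_const -[RHS]mulr_natr divfK // pnatr_eq0 -lt0n.
    by apply/card_gt0P; exists i0; rewrite mem_block.
  rewrite [LHS]big_mkcond; apply: eq_bigr => i _; rewrite !mxE !mem_block eq_sym.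
  case: eqP => [E|]; last by rewrite mulr0.
  by rewrite mulr1 E (tc _ _ E).
apply: memv_suml => i _; apply/memvZ/memv_span/map_f; rewrite mem_enum.
exact/finset.pblock_mem/interval_partition_cover.
Qed.

(** The projection exists: it replaces each line of x by its block averages. *)
Lemma orthprojP (x : 'M[R]_(r, n)) :
  is_orthproj (hist_space R m) x (orthproj (hist_space R m) x).
Proof.
apply: (xgetPex 0); pose b i := #|finset.pblock m i|%:R : R.
exists (\matrix_(j, i) ((\sum_(i' in finset.pblock m i) x j i') / b i)); split.
  by apply/in_tensor_hist => i i' E j; rewrite !mxE /b E.
move=> t /in_tensor_hist tc; rewrite innerBl; apply/eqP; rewrite subr_eq0; apply/eqP.
rewrite /inner exchange_big [RHS]exchange_big; apply: eq_bigr => j _ /=.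
under [RHS]eq_bigr do rewrite mxE !mulr_suml.
rewrite (exchange_big_dep xpredT) //=; apply: eq_bigr => i' _.
transitivity (\sum_(i in finset.pblock m i') x j i' / b i' * t j i').
  rewrite sumr_const -[RHS]mulr_natr -/(b i') [RHS]mulrAC divfK // pnatr_eq0 -lt0n.
  by apply/card_gt0P; exists i'; rewrite mem_block.
apply: eq_big => [i|i]; rewrite !mem_block 1?eq_sym // => /eqP E.
by rewrite /b E (tc _ _ E).
Qed.

End HistogramSpace.

Section PenalizedSelection.
Variables (R : realType) (r n : nat).

(** The estimate and s are both constant on the pieces cut by the left ends of m
    and of m0, so the noise acts on their difference only through its energy on
    these pieces; half of the squared loss is given up to absorb the pairing. *)
Lemma selected_loss_le (pen : {set {set 'I_n}} -> R) (x s : 'M[R]_(r, n))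
    (m m0 : {set {set 'I_n}}) :
  is_selected (interval_partitions n) (hist_space R (n:=n)) pen x m ->
  m0 \in interval_partitions n -> in_tensor (hist_space R m0) s ->
  norm2 (s - orthproj (hist_space R m) x) ^+ 2 <=
  2 * (pen m0 - pen m)
  + 4 * cell_energy (piece (left_ends m :|: left_ends m0)) (x - s).
Proof.
move=> [mP msel] m0P sS; have := msel m0 m0P; rewrite /criterion.
set B := left_ends m :|: left_ends m0.
set u := orthproj (hist_space R m) x => crit.
have := contrast_orthproj_le (orthprojP m0P x) sS => opt.
have cc i i' : piece B i = piece B i' -> forall j, (u - s) j i = (u - s) j i'.
  move=> E j; have [uS _] := orthprojP mP x.
  have mE := eq_piece_pblock mP (finset.subsetUl _ _) E.
  have m0E := eq_piece_pblock m0P (finset.subsetUr _ _) E.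
  move: uS sS => /(in_tensor_hist mP) uc /(in_tensor_hist m0P) sc.
  by rewrite mxE [RHS]mxE (uc _ _ mE) [in LHS]mxE (sc _ _ m0E) [in RHS]mxE.
have := cell_pairing_le (x - s) cc.
rewrite norm2_sqr; move: crit opt; rewrite /contrast !norm2_sqr -/u.
rewrite !(innerBl, innerBr) (innerC u s); lra.
Qed.

End PenalizedSelection.

(** * Upper bound on the risk of the penalized estimator *)

Section UpperBound.
Variables (R : realType) (r n : nat).

Lemma card_piece_image (B : {set 'I_n}) :
  (#|[set piece B i | i : 'I_n]| <= #|B|.+1)%N.
Proof. by rewrite -[leqRHS]card_ord max_card. Qed.

Lemma ln_ratio_ge0 (D : nat) : (D <= n)%N -> 0 <= ln (n%:R / D%:R) :> R.
Proof.
case: D => [|D] Dn; first by rewrite invr0 mulr0 ln0.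
by rewrite ln_ge0 // ler_pdivlMr ?ltr0n // mul1r ler_nat.
Qed.

(** The level above which the energy on a refinement of a k-piece partition by
    D further left ends is considered large: 4 times a bound on the number of
    pieces, plus 1 / lam = 64 times the logarithm of the weight of a set of
    size D. *)
Definition energy_level (k D : nat) : R :=
  4 * (D%:R + k%:R + 1) + 64 * (D%:R * ln (n%:R / D%:R) + 3 * D%:R).

(** A smooth upper bound for the supremum over A of lam (Z_A - level_A) with
    lam = 1/64; it does not depend on the selected partition. *)
Definition excess (s : 'M[R]_(r, n)) (A0 : {set 'I_n}) (x : 'M[R]_(r, n)) : R :=
  \sum_(A : {set 'I_n})
    expR (64^-1 * (cell_energy (piece (A :|: A0)) (x - s) - energy_level #|A0| #|A|)).

Lemma expect_excess_le (s : 'M[R]_(r, n)) (A0 : {set 'I_n}) : prob_columns s ->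
  expect s (excess s A0) <= 2.
Proof.
move=> sP; rewrite /expect /excess.
under eq_bigr do rewrite mulr_sumr.
rewrite exchange_big /= (le_trans _ (sum_subset_weights R n)) //.
apply: ler_sum => A _.
under eq_bigr do rewrite mulrBr expRD mulrA.
rewrite -mulr_suml.
have lam : 0 <= (64^-1 : R) <= 64^-1 by rewrite lexx andbT invr_ge0.
have mom := expect_exp_energy sP (piece (A :|: A0)) lam.
apply: (@le_trans _ _ (expR (4 * 64^-1 * (#|A|%:R + #|A0|%:R + 1))
                       * expR (- (64^-1 * energy_level #|A0| #|A|)))).
  rewrite ler_wpM2r ?expR_ge0 // (le_trans mom) // ler_expR.
  rewrite ler_wpM2l ?mulr_ge0 ?invr_ge0 //.
  rewrite -natrD natr1 ler_nat (leq_trans (card_piece_image _)) // ltnS.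
  exact: leq_card_setU.
by rewrite -expRD ler_expR /energy_level; lra.
Qed.

(** The thresholds 128 = 2 * 64 and 392 = 2 * (4 + 3 * 64) are those for which
    twice the penalty of m dominates four times the part of the energy level
    that depends on m. *)
Lemma EI_loss_le (c1 c2 : R) (s x : 'M[R]_(r, n)) (m m0 : {set {set 'I_n}}) :
  128 <= c1 -> 392 <= c2 ->
  is_selected (interval_partitions n) (hist_space R (n:=n)) (EI_pen c1 c2) x m ->
  m0 \in interval_partitions n -> in_tensor (hist_space R m0) s ->
  norm2 (s - orthproj (hist_space R m) x) ^+ 2 <=
  2 * (#|m0|%:R * (c1 * ln (n%:R / #|m0|%:R) + c2)) + 16 * (#|m0|%:R + 1)
  + 256 * excess s (left_ends m0) x.
Proof.
move=> c1P c2P sel m0P sS; have mP := proj1 sel.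
apply: le_trans (selected_loss_le sel m0P sS) _.
rewrite /EI_pen !dim_hist_space //.
have Lm : #|left_ends m| = #|m| by exact: card_left_ends.
have Lm0 : #|left_ends m0| = #|m0| by exact: card_left_ends.
set Z := cell_energy _ _; set W := excess _ _ _.
have ZW : 64^-1 * (Z - energy_level #|m0| #|m|) <= W.
  rewrite /W /excess (bigD1 (left_ends m)) //= Lm Lm0 -/Z.
  rewrite ler_wpDr ?sumr_ge0 //.
  by apply: le_trans (expR_ge1Dx _); rewrite lerDr.
have mn : (#|m| <= n)%N by rewrite -Lm -[leqRHS]card_ord max_card.
have Dl : 0 <= #|m|%:R * ln (n%:R / #|m|%:R) :> R by rewrite mulr_ge0 // ln_ratio_ge0.
have D0 : 0 <= #|m|%:R :> R by [].
have slack1 : 0 <= (c1 - 128) * (#|m|%:R * ln (n%:R / #|m|%:R)).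
  by apply: mulr_ge0; [rewrite subr_ge0 | exact: Dl].
have slack2 : 0 <= (c2 - 392) * #|m|%:R.
  by apply: mulr_ge0; [rewrite subr_ge0 | exact: D0].
by move: ZW; rewrite /energy_level; lra.
Qed.

Lemma EI_risk_le (c1 c2 : R) (st : estimator R r n) (k : nat) (s : 'M[R]_(r, n)) :
  128 <= c1 -> 392 <= c2 -> is_EI_estimator c1 c2 st ->
  (0 < k)%N -> pw_const_class R r n k s ->
  risk s st <= 2 * (c1 + c2 + 272) * (k%:R * (1 + ln (n%:R / k%:R))).
Proof.
move=> c1P c2P stP k0 [sP [m0 [m0P m0k m0c]]].
have sS : in_tensor (hist_space R m0) s.
  apply/(in_tensor_hist m0P) => i i' E j.
  apply: (m0c (finset.pblock m0 i)).
  - exact/finset.pblock_mem/interval_partition_cover.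
  - by rewrite eq_pblockE.
  - by rewrite eq_pblockE // E.
rewrite /risk /expect.
set c0 := 2 * (k%:R * (c1 * ln (n%:R / k%:R) + c2)) + 16 * (k%:R + 1).
apply: (@le_trans _ _ (\sum_w law s w * (c0 + 256 * excess s (left_ends m0) (Xval R w)))).
  apply: ler_sum => w _; apply: ler_wpM2l.
    by apply: prodr_ge0 => i _; case: (sP i) => ->.
  case: (stP w) => m sel ->.
  by have := EI_loss_le c1P c2P sel m0P sS; rewrite m0k.
under eq_bigr do rewrite mulrDr mulrCA.
rewrite big_split /= -mulr_suml -mulr_sumr law_sum1 // mul1r.
have := expect_excess_le (left_ends m0) sP; rewrite /expect => EW.
have k1 : 1 <= k%:R :> R by rewrite ler1n.
have kn : (k <= n)%N by rewrite -m0k -(card_left_ends m0P) -[leqRHS]card_ord max_card.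
have L0 : 0 <= k%:R * ln (n%:R / k%:R) :> R by rewrite mulr_ge0 // ln_ratio_ge0.
have : 0 <= c2 * (k%:R * ln (n%:R / k%:R)) by rewrite mulr_ge0 //; lra.
have : 0 <= c1 * k%:R by rewrite mulr_ge0 //; lra.
by rewrite /c0; lra.
Qed.

End UpperBound.

(** * Lower bound for one block *)

Section Testing.
Variable R : realType.

(** The hypotheses P_j are compared with a common reference Q.  At most one j,
    the minimizer b of the loss, has loss below d, so the sum loses at most the
    mass P_b, and P_b <= M Q / 2 + P_b^2 / (2 M Q) is controlled by the second
    moments.  The condition on the zeros of Q is absolute continuity. *)
Lemma testing_bound (J : finType) (loss P : J -> R) (Q d : R) :
  (0 < #|J|)%N -> 0 <= d -> 0 <= Q -> (Q = 0 -> forall j, P j = 0) ->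
  (forall j, 0 <= P j) -> (forall j, 0 <= loss j) ->
  (forall j j', j != j' -> 2 * d <= loss j + loss j') ->
  d * (\sum_j P j - #|J|%:R / 2 * Q - (2 * #|J|%:R)^-1 * \sum_j P j ^+ 2 / Q)
    <= \sum_j P j * loss j.
Proof.
move=> /card_gt0P [x0 _] d0 Q0 PQ P0 l0 sep.
have M0 : 0 < #|J|%:R :> R by rewrite ltr0n; apply/card_gt0P; exists x0.
case: (@Order.TotalTheory.arg_minP _ R J x0 xpredT loss isT) => b _ bmin.
have ld j : j != b -> d <= loss j.
  by move=> jb; have := sep _ _ jb; have := bmin j isT; lra.
apply: (@le_trans _ _ (d * (\sum_j P j - P b))); last first.
  rewrite (bigD1 b) //= addrAC subrr add0r [leRHS](bigD1 b) //= ler_wpDl ?mulr_ge0 //.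
  by rewrite mulr_sumr; apply: ler_sum => j jb; rewrite mulrC ler_wpM2l // ld.
apply: ler_wpM2l => //; rewrite -addrA -opprD lerD2l lerN2.
have term0 j : 0 <= P j ^+ 2 / Q by rewrite divr_ge0 // sqr_ge0.
apply: (@le_trans _ _ (#|J|%:R / 2 * Q + (2 * #|J|%:R)^-1 * (P b ^+ 2 / Q))).
  have [Qz|Qn] := eqVneq Q 0; first by rewrite Qz (PQ Qz) !(mulr0, expr0n, mul0r) addr0.
  have Qp : 0 < Q by rewrite lt_neqAle eq_sym Qn.
  have : 0 <= (P b - #|J|%:R * Q) ^+ 2 / (2 * #|J|%:R * Q).
    by rewrite divr_ge0 ?sqr_ge0 // !mulr_ge0 // ltW.
  suff -> : (P b - #|J|%:R * Q) ^+ 2 / (2 * #|J|%:R * Q)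
    = #|J|%:R / 2 * Q + (2 * #|J|%:R)^-1 * (P b ^+ 2 / Q) - P b by lra.
  by field; rewrite !gt_eqF.
rewrite lerD2l ler_wpM2l ?invr_ge0 ?mulr_ge0 // (bigD1 b) //= lerDl.
by apply: sumr_ge0.
Qed.

End Testing.

Section Bumps.
Variables (R : realType) (r n : nat) (j0 j1 : 'I_r).
Hypothesis j01 : j0 != j1.

Definition bump_col (b : bool) (j : 'I_r) : R :=
  if j == j0 then (if b then 3 / 4 else 1 / 2)
  else if j == j1 then (if b then 1 / 4 else 1 / 2) else 0.

Definition bump_mx (T : {set 'I_n}) : 'M[R]_(r, n) :=
  \matrix_(j, i) bump_col (i \in T) j.

Lemma bump_col_ge0 b j : 0 <= bump_col b j.
Proof. by rewrite /bump_col; do ![case: ifP => _]; rewrite ?divr_ge0. Qed.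

Lemma sum_two_points (F : 'I_r -> R) :
  (forall j, j != j0 -> j != j1 -> F j = 0) -> \sum_j F j = F j0 + F j1.
Proof.
move=> F0; rewrite (bigD1 j0) //= (bigD1 j1) 1?eq_sym //=.
by rewrite big1 ?addr0 // => j /andP[a b]; apply: F0.
Qed.

Lemma bump_mx_prob (T : {set 'I_n}) : prob_columns (bump_mx T).
Proof.
move=> i; split=> [j|]; first by rewrite mxE bump_col_ge0.
rewrite sum_two_points => [|j a b]; last by rewrite mxE /bump_col (negPf a) (negPf b).
rewrite !mxE /bump_col !eqxx [j1 == j0]eq_sym (negPf j01).
by case: (i \in T); lra.
Qed.

Lemma chi2_bump_col (b b' : bool) : (b' -> b) ->
  \sum_j bump_col b j ^+ 2 / bump_col b' j = if b && ~~ b' then 5 / 4 else 1.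
Proof.
move=> bb; rewrite sum_two_points => [|j x y]; last first.
  by rewrite /bump_col (negPf x) (negPf y) expr0n mul0r.
rewrite /bump_col !eqxx [j1 == j0]eq_sym (negPf j01).
by case: b b' bb => [] [] //= bb; [field|field|have := bb isT|field].
Qed.

(** The second moment of the likelihood ratio is multiplicative over the columns,
    and each bump column contributes (9/16 + 1/16) / (1/2) = 5/4. *)
Lemma chi2_bump_law (T T0 : {set 'I_n}) : T0 \subset T ->
  \sum_(w : outcome r n) law (bump_mx T) w ^+ 2 / law (bump_mx T0) w
  = (5 / 4) ^+ #|T :\: T0|.
Proof.
move=> sT.
transitivity (\sum_(w : outcome r n) \prod_i
   (bump_col (i \in T) (w i) ^+ 2 / bump_col (i \in T0) (w i))).
  apply: eq_bigr => w _; rewrite /law -prodrXl -prodfV -big_split /=.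
  by apply: eq_bigr => i _; rewrite !mxE.
rewrite -(bigA_distr_bigA (fun i j => bump_col (i \in T) j ^+ 2 / bump_col (i \in T0) j)).
rewrite -prodr_const [RHS]big_mkcond; apply: eq_bigr => i _ /=.
by rewrite chi2_bump_col ?inE 1?andbC //; apply: (fintype.subsetP sT).
Qed.

Lemma bump_law_ac (T T0 : {set 'I_n}) w :
  law (bump_mx T0) w = 0 -> law (bump_mx T) w = 0.
Proof.
move=> /eqP /prodf_eq0 [i _]; rewrite mxE => /eqP E.
suff Z : bump_col (i \in T) (w i) = 0.
  by apply/eqP/prodf_eq0; exists i => //; rewrite mxE Z.
move: E; rewrite /bump_col; case: ifP => _; first by case: (i \in T0); lra.
by case: ifP => _ //; case: (i \in T0); lra.
Qed.

Lemma bump_mx_j0 (T : {set 'I_n}) i :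
  bump_mx T j0 i = if i \in T then 3 / 4 else 1 / 2.
Proof. by rewrite mxE /bump_col eqxx. Qed.

(** T0 carries the bumps of the other blocks and is common to all hypotheses.
    The loss is measured on the line j0 only.  Two hypotheses differ there by
    1/4 on 2 l indices, so at each of these indices their two squared errors sum
    to at least 1/32. *)
Lemma one_block_bound (J : finType) (l : nat) (T0 U : {set 'I_n})
    (slot : J -> {set 'I_n}) (a : outcome r n -> 'I_n -> R) :
  (0 < #|J|)%N -> (5 / 4) ^+ l <= 5 / 8 * #|J|%:R :> R ->
  (forall j, #|slot j| = l) -> (forall j, slot j \subset U) ->
  (forall j, [disjoint slot j & T0]) ->
  (forall j j', j != j' -> [disjoint slot j & slot j']) ->
  #|J|%:R * (3 / 512 * l%:R) <=
  \sum_j \sum_w law (bump_mx (T0 :|: slot j)) w *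
     \sum_(i in U) (bump_mx (T0 :|: slot j) j0 i - a w i) ^+ 2.
Proof.
move=> J0 chi card sU sT0 disj.
pose P j w := law (bump_mx (T0 :|: slot j)) w; pose Q w := law (bump_mx T0) w.
pose loss w j := \sum_(i in U) (bump_mx (T0 :|: slot j) j0 i - a w i) ^+ 2.
have law0 T w : 0 <= law (bump_mx T) w.
  by apply: prodr_ge0 => i _; rewrite mxE bump_col_ge0.
have M0 : 0 < #|J|%:R :> R by rewrite ltr0n.
pose d : R := l%:R / 32.
have d0 : 0 <= d by rewrite divr_ge0.
have in_slot j j' i : i \in slot j -> (i \in T0 :|: slot j') = (j == j').
  move=> ij; rewrite inE (disjointFr (sT0 j) ij) /=.
  have [<-//|jj'] := eqVneq j j'.
  exact: disjointFr (disj _ _ jj') ij.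
have count j : \sum_(i in U) (i \in slot j)%:R = l%:R :> R.
  rewrite -(card j) -sumr_const big_mkcond [RHS]big_mkcond /=.
  apply: eq_bigr => i _; case ij : (i \in slot j); last by case: ifP.
  by rewrite (fintype.subsetP (sU j) _ ij).
have sep w j j' : j != j' -> 2 * d <= loss w j + loss w j'.
  move=> jj'; rewrite /loss -big_split /=.
  apply: (@le_trans _ _ (\sum_(i in U)
            (32^-1 * (i \in slot j)%:R + 32^-1 * (i \in slot j')%:R))).
    by rewrite big_split /= -!mulr_sumr !count /d; lra.
  apply: ler_sum => i _; rewrite !bump_mx_j0.
  have sq (x : R) : 0 <= x ^+ 2 by apply: sqr_ge0.
  case ij: (i \in slot j) => /=.
    rewrite !(in_slot j) // eqxx (negPf jj').
    have -> : (i \in slot j') = false by apply: disjointFr (disj _ _ jj') ij.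
    by have := sq (a w i - 5 / 8); rewrite /=; lra.
  case ij': (i \in slot j') => /=.
    rewrite !(in_slot j') // eqxx eq_sym (negPf jj').
    by have := sq (a w i - 5 / 8); rewrite /=; lra.
  by rewrite !mulr0 addr0 addr_ge0.
apply: (@le_trans _ _ (\sum_w d * (\sum_j P j w - #|J|%:R / 2 * Q w
     - (2 * #|J|%:R)^-1 * \sum_j P j w ^+ 2 / Q w))); last first.
  rewrite exchange_big /=; apply: ler_sum => w _.
  apply: testing_bound => // [|Qz j|j|j|j j' jj']; last exact: sep.
  - exact: law0.
  - exact: bump_law_ac Qz.
  - exact: law0.
  - by apply: sumr_ge0 => i _; apply: sqr_ge0.
rewrite -mulr_sumr !sumrB -!mulr_sumr exchange_big /=.
under [X in _ <= _ * (X - _ - _)]eq_bigr do rewrite (law_sum1 (bump_mx_prob _)).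
rewrite (law_sum1 (bump_mx_prob _)) sumr_const -[1 *+ _]/(#|J|%:R).
rewrite [X in _ <= _ * (_ - _ * X)]exchange_big /=.
have chi2 j : \sum_w P j w ^+ 2 / Q w = (5 / 4) ^+ l.
  rewrite chi2_bump_law ?finset.subsetUl // -(card j); congr (_ ^+ _).
  by rewrite finset.setDUl finset.setDv finset.set0U (finset.setDidPl _) // sT0.
under [X in _ <= _ * (_ - _ * X)]eq_bigr do rewrite chi2.
rewrite sumr_const -[(5 / 4) ^+ l *+ _]mulr_natr.
have -> : (2 * #|J|%:R)^-1 * ((5 / 4) ^+ l * #|J|%:R) = (5 / 4) ^+ l / 2 :> R.
  by field; rewrite gt_eqF.
have : d * (5 / 4) ^+ l <= d * (5 / 8 * #|J|%:R) by apply: ler_wpM2l.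
by rewrite /d; lra.
Qed.

End Bumps.

(** * Lower bound for many blocks *)

Section ManyBlocks.
Variables (R : realType) (r n K M : nat) (j0 j1 : 'I_r).
Hypothesis j01 : j0 != j1.
Variable code : 'I_n -> option ('I_K * 'I_M).

(** The index i belongs to slot j of block b when code i = Some (b, j), and
    sigma gives the slot of the bump in each block. *)
Definition bump_set (sigma : {ffun 'I_K -> 'I_M}) : {set 'I_n} :=
  [set i | if code i is Some (b, j) then j == sigma b else false].

Definition in_block (b : 'I_K) (i : 'I_n) : bool :=
  if code i is Some (b', _) then b' == b else false.

Lemma sum_blocks_le (F : 'I_n -> R) : (forall i, 0 <= F i) ->
  \sum_b \sum_(i | in_block b i) F i <= \sum_i F i.
Proof.
move=> F0; rewrite (exchange_big_dep xpredT) //=; apply: ler_sum => i _.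
rewrite /in_block; case: (code i) => [[b' j]|]; last by rewrite big_pred0.
by rewrite (eq_bigl (pred1 b')) ?big_pred1_eq // => b; rewrite /= eq_sym.
Qed.

(** Average over all sigma.  For each block, resampling the coordinate sigma b
    reduces the average to the situation of a single block, all other bumps
    being held fixed. *)
Lemma many_blocks_bound (l : nat) (shat : estimator R r n) :
  (0 < M)%N -> (5 / 4) ^+ l <= 5 / 8 * M%:R :> R ->
  (forall b j, #|[set i | code i == Some (b, j)]| = l) ->
  exists sigma, 3 / 512 * (K%:R * l%:R) <= risk (bump_mx R j0 j1 (bump_set sigma)) shat.
Proof.
move=> M0 chi card.
pose s sigma := bump_mx R j0 j1 (bump_set sigma).
pose sq sigma w i := (s sigma j0 i - shat (Xval R w) j0 i) ^+ 2.
pose G b sigma := \sum_w law (s sigma) w * \sum_(i | in_block b i) sq sigma w i.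
have law0 T w : 0 <= law (bump_mx R j0 j1 T : 'M_(r, n)) w.
  by apply: prodr_ge0 => i _; rewrite mxE bump_col_ge0.
have riskG sigma : \sum_b G b sigma <= risk (s sigma) shat.
  rewrite exchange_big /=; apply: ler_sum => w _.
  rewrite -mulr_sumr; apply: ler_wpM2l; first exact: law0.
  apply: le_trans (sum_blocks_le _) _; first by move=> i; apply: sqr_ge0.
  rewrite norm2_sqr; apply: ler_sum => i _.
  rewrite (bigD1 j0) //= !mxE -expr2. rewrite /sq /s mxE lerDl; apply: sumr_ge0 => j _.
  by rewrite -expr2 sqr_ge0.
have Mr : 0 < M%:R :> R by rewrite ltr0n.
have block b sigma : M%:R * (3 / 512 * l%:R) <= \sum_j G b (upd sigma b j).
  pose T0 := [set i | if code i is Some (b', j) then (b' != b) && (j == sigma b') else false].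
  pose slot j := [set i | code i == Some (b, j)].
  have TE j : bump_set (upd sigma b j) = T0 :|: slot j.
    apply/setP => i; rewrite !inE; case: (code i) => [[b' j']|] //=.
    rewrite ffunE -[Some _ == Some _]/((b', j') == (b, j)) -pair_eqE /pair_eq /=.
    by case: (b' == b); rewrite /= ?orbF.
  have := @one_block_bound R r n j0 j1 j01 'I_M l T0 [set i | in_block b i] slot
            (fun w i => shat (Xval R w) j0 i).
  rewrite card_ord => /(_ M0 chi (card b)) H.
  apply: le_trans (H _ _ _) _.
  - move=> j; apply/fintype.subsetP => i; rewrite !inE /in_block.
    by move=> /eqP ->.
  - move=> j; rewrite -finset.setI_eq0; apply/eqP/setP => i; rewrite !inE.
    by case: eqP => // ->; rewrite eqxx.
  - move=> j j' jj'; rewrite -finset.setI_eq0; apply/eqP/setP => i; rewrite !inE.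
    case: eqP => //= ->; apply/negbTE; apply: contraNneq jj' => -[->].
    exact: eqxx.
  rewrite /G /sq /s; apply: ler_sum => j _; rewrite TE; apply: ler_sum => w _.
  apply: ler_wpM2l; first exact: law0.
  by rewrite le_eqVlt; apply/orP; left; apply/eqP/eq_bigl => i; rewrite inE.
have avg b : #|{ffun 'I_K -> 'I_M}|%:R * (3 / 512 * l%:R) <= \sum_sigma G b sigma.
  have := sum_resample (fun (_ : 'I_K) (_ : 'I_M) => 1 : R) (G b) b.
  rewrite sumr_const card_ord -[1 *+ M]/(M%:R).
  under [X in _ = _ * X]eq_bigr do rewrite big1 // mul1r.
  move=> E; rewrite -(ler_pM2l Mr) -E.
  rewrite mulrCA -sumr_const mulr_suml; apply: ler_sum => sigma _.
  rewrite big1 // !mul1r.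
  by under eq_bigr do rewrite mul1r; apply: block.
apply: contrapT => none.
have lt sigma : risk (s sigma) shat < 3 / 512 * (K%:R * l%:R).
  by rewrite ltNge; apply/negP => H; apply: none; exists sigma.
have sig0 : {ffun 'I_K -> 'I_M} by exact: [ffun=> Ordinal M0].
have : \sum_sigma \sum_b G b sigma <
    \sum_(sigma : {ffun 'I_K -> 'I_M}) 3 / 512 * (K%:R * l%:R).
  apply: ltr_sum; last by move=> sigma _; apply: le_lt_trans (lt sigma).
  by apply/hasP; exists sig0; rewrite ?mem_index_enum.
rewrite exchange_big /= sumr_const ltNge => /negP; apply.
apply: (@le_trans _ _ (\sum_(b < K) #|{ffun 'I_K -> 'I_M}|%:R * (3 / 512 * l%:R))).
  rewrite sumr_const card_ord -[_ *+ K]mulr_natr -[leLHS]mulr_natr.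
  by rewrite le_eqVlt; apply/orP; left; apply/eqP; ring.
by apply: ler_sum => b _.
Qed.

End ManyBlocks.

Section ClassMembership.
Variables (R : realType) (r n : nat) (j0 j1 : 'I_r).
Hypothesis j01 : j0 != j1.

Lemma extend_set (k : nat) (B : {set 'I_n}) : (#|B| <= k <= n)%N ->
  exists2 B' : {set 'I_n}, B \subset B' & #|B'| = k.
Proof.
elim: k => [|k IH] /andP[Bk kn].
  by exists B => //; apply/eqP; move: Bk; rewrite leqn0.
move: Bk; rewrite leq_eqVlt => /orP[/eqP Bk|Bk]; first by exists B.
have [|B' BB' cB'] := IH; first by rewrite -ltnS Bk (ltnW kn).
have /set0Pn [x] : ~: B' != finset.set0.
  by rewrite -card_gt0 cardsCs finset.setCK card_ord cB' subn_gt0.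
rewrite inE => xB'; exists (x |: B'); last by rewrite cardsU1 xB' cB'.
exact: fintype.subset_trans BB' (finset.subsetUr _ _).
Qed.

(** The breakpoints B are completed by the first index and by arbitrary further
    ones, so as to obtain exactly k intervals. *)
Lemma bump_mx_class (k : nat) (T B : {set 'I_n}) : (0 < n)%N ->
  (#|B| < k <= n)%N ->
  (forall i i' : 'I_n, (i <= i')%N ->
     (forall a : 'I_n, a \in B -> (i < a <= i')%N -> False) ->
     (i \in T) = (i' \in T)) ->
  pw_const_class R r n k (bump_mx R j0 j1 T).
Proof.
move=> n0 /andP[Bk kn] TB; split; first exact: bump_mx_prob.
have [|B' BB' cB'] := @extend_set k (Ordinal n0 |: B).
  by rewrite kn andbT cardsU1; case: (_ \notin _); rewrite ?add1n ?add0n // ltnW.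
exists (pieces B'); split.
- exact: pieces_interval.
- by rewrite card_pieces // (fintype.subsetP BB') // !inE eqxx.
move=> J Jm i i' iJ i'J j; rewrite !mxE; congr (bump_col _ _ _ _ _).
have : piece B' i = piece B' i'.
  apply: eq_pblock_pieces; have tr := interval_partition_triv (pieces_interval B').
  by rewrite (finset.def_pblock tr Jm iJ) (finset.def_pblock tr Jm i'J).
have le (x y : 'I_n) : (x <= y)%N -> piece B' x = piece B' y -> (x \in T) = (y \in T).
  move=> xy /(eq_piece _ xy) none; apply: TB => // a aB; apply: none.
  by apply: (fintype.subsetP BB'); rewrite !inE aB orbT.
case/orP: (leq_total i i') => ii' E; first exact: le.
exact/esym/le.
Qed.

End ClassMembership.

Section SlotLayout.
Variables (n K M l : nat).
Hypotheses (M0 : (0 < M)%N) (l0 : (0 < l)%N) (fits : (K * M * l <= n)%N).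

Definition slot_code (i : 'I_n) : option ('I_K * 'I_M) :=
  omap (fun b => (b, Ordinal (ltn_pmod (i %/ l) M0))) (insub (i %/ l %/ M)%N).

Definition slot_start (b : 'I_K) (j : 'I_M) : nat := (b * M + j) * l.

Lemma slot_endE (b : 'I_K) (j : 'I_M) :
  (slot_start b j + l = (b * M + j).+1 * l)%N.
Proof. by rewrite /slot_start mulSn addnC. Qed.

Lemma slot_codeE i b j :
  (slot_code i == Some (b, j)) = (slot_start b j <= i < slot_start b j + l)%N.
Proof.
rewrite slot_endE /slot_start -leq_divRL // -ltn_divLR // ltnS -eqn_leq.
rewrite /slot_code; apply/eqP/eqP => [|E].
  by case: insubP => //= c _ cE -[<- <-] /=; rewrite cE -divn_eq.
rewrite -E divnMDl // divn_small // addn0 insubT //= => b_lt.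
by congr (Some (_, _)); apply: val_inj; rewrite /= -?E ?modnMDl ?modn_small.
Qed.

Lemma slot_fits (b : 'I_K) (j : 'I_M) : (slot_start b j + l <= n)%N.
Proof.
apply: leq_trans fits; rewrite slot_endE leq_pmul2r //.
by have := ltn_ord b; have := ltn_ord j; nia.
Qed.

Lemma card_segment (u : nat) : (u + l <= n)%N ->
  #|[set i : 'I_n | (u <= i < u + l)%N]| = l.
Proof.
move=> un; have lt (x : 'I_l) : (u + x < n)%N by have := ltn_ord x; lia.
rewrite -[RHS]card_ord -(card_imset 'I_l (f := fun x => Ordinal (lt x))); last first.
  by move=> x y [] /addnI /val_inj.
apply: eq_card => i; rewrite inE; apply/idP/imsetP => [/andP[ui iu]|[x _ ->]].
  have xl : (i - u < l)%N by lia.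
  by exists (Ordinal xl) => //; apply: val_inj => /=; rewrite subnKC.
by rewrite /= leq_addr ltn_add2l ltn_ord.
Qed.

Lemma card_slot b j : #|[set i | slot_code i == Some (b, j)]| = l.
Proof.
rewrite -[RHS](card_segment (slot_fits b j)).
by apply: eq_card => i; rewrite !inE slot_codeE.
Qed.

Lemma mem_bump_set (sigma : {ffun 'I_K -> 'I_M}) (i : 'I_n) : reflect
  (exists b, (slot_start b (sigma b) <= i < slot_start b (sigma b) + l)%N)
  (i \in bump_set slot_code sigma).
Proof.
rewrite inE; apply: (iffP idP) => [|[b]].
  case E: (slot_code i) => [[b j]|] // /eqP js; exists b.
  by rewrite -slot_codeE E js.
by rewrite -slot_codeE => /eqP ->.
Qed.

(** Starts of the bumps and first indices after them.  An end equal to n falls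
    outside 'I_n and is replaced by the default 0, a harmless extra
    breakpoint. *)
Definition slot_ends (n0 : (0 < n)%N) (sigma : {ffun 'I_K -> 'I_M}) : {set 'I_n} :=
  [set insubd (Ordinal n0) (slot_start b (sigma b)) | b : 'I_K] :|:
  [set insubd (Ordinal n0) (slot_start b (sigma b) + l)%N | b : 'I_K].

Lemma card_slot_ends n0 sigma : (#|slot_ends n0 sigma| <= K.*2)%N.
Proof.
rewrite -addnn (leq_trans (leq_card_setU _ _)) // leq_add //.
  by rewrite (leq_trans (leq_imset_card _ _)) // card_ord.
by rewrite (leq_trans (leq_imset_card _ _)) // card_ord.
Qed.

Lemma bump_set_const n0 sigma (i i' : 'I_n) : (i <= i')%N ->
  (forall a : 'I_n, a \in slot_ends n0 sigma -> (i < a <= i')%N -> False) ->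
  (i \in bump_set slot_code sigma) = (i' \in bump_set slot_code sigma).
Proof.
move=> ii' none.
have no_end (x : nat) : (x < n)%N -> insubd (Ordinal n0) x \in slot_ends n0 sigma ->
    (i < x <= i')%N -> False.
  by move=> xn /none; rewrite val_insubd xn.
have i'n := ltn_ord i'.
apply/mem_bump_set/mem_bump_set => -[b /andP[lo hi]]; exists b.
  rewrite (leq_trans lo ii') /= ltnNge; apply/negP => ge.
  apply: (no_end (slot_start b (sigma b) + l)%N); first exact: leq_ltn_trans ge _.
    by rewrite inE (imset_f (fun b => insubd _ _)) ?orbT.
  by rewrite hi ge.
rewrite (leq_ltn_trans ii' hi) andbT leqNgt; apply/negP => lt.
apply: (no_end (slot_start b (sigma b))); first exact: leq_ltn_trans lo _.
  by rewrite inE (imset_f (fun b => insubd _ _)).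
by rewrite lt lo.
Qed.

End SlotLayout.

Section LowerBound.
Variable R : realType.

(** With N = n / K >= 2 indices available per block, take l such that
    2 ^ (2 l - 1) <= N < 2 ^ (2 l + 1).  Then 2 ^ l slots of length
    l <= 2 ^ (l - 1) fit into a block, and ln (n / k) <= 3 l, while k <= 4 K. *)
Lemma minimax_lower (r n k : nat) (shat : estimator R r n) :
  (2 <= r)%N -> (3 <= k <= n)%N ->
  exists2 s, pw_const_class R r n k s &
    3 / 512 / 16 * (k%:R * (1 + ln (n%:R / k%:R))) <= risk s shat.
Proof.
move=> r2 /andP[k3 kn].
have n0 : (0 < n)%N by lia.
pose K := (k.-1)./2; pose N := (n %/ K)%N; pose p := trunc_log 2 N.
pose l := uphalf p; pose M := (2 ^ l)%N.
have K2 : (K.*2 < k)%N by rewrite /K; lia.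
have K4 : (k <= 4 * K)%N by rewrite /K; lia.
have K0 : (0 < K)%N by lia.
have N2 : (2 <= N)%N by rewrite /N leq_divRL //; lia.
have p1 : (0 < p)%N by rewrite /p trunc_log_gt0.
have l0 : (0 < l)%N by rewrite /l; lia.
have M0 : (0 < M)%N by rewrite expn_gt0.
have [pN Np] := (trunc_logP (isT : 1 < 2)%N (ltnW N2), trunc_log_ltn N (isT : 1 < 2)%N).
have fits : (K * M * l <= n)%N.
  have MlN : (M * l <= N)%N.
    apply: leq_trans pN; apply: (@leq_trans (2 ^ (l + l.-1))).
      by rewrite expnD leq_mul2l -{1}(prednK l0) ltn_expl ?orbT.
    by rewrite leq_exp2l //; rewrite /l; lia.
  by rewrite -mulnA (leq_trans (leq_mul (leqnn K) MlN)) // mulnC leq_trunc_div.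
have j01 : Ordinal (ltnW r2) != Ordinal r2 by [].
have chi : (5 / 4) ^+ l <= 5 / 8 * M%:R :> R.
  rewrite /M -(prednK l0) exprS expnS natrM natrX.
  have : (5 / 4) ^+ l.-1 <= 2 ^+ l.-1 :> R.
    by apply: lerXn2r; rewrite ?nnegrE ?divr_ge0 //; lra.
  by lra.
have [sigma Hs] := many_blocks_bound j01 shat M0 chi (card_slot M0 l0 fits).
exists (bump_mx R (Ordinal (ltnW r2)) (Ordinal r2) (bump_set (slot_code K l M0) sigma)).
  apply: (@bump_mx_class R r n _ _ j01 k _ (slot_ends l n0 sigma) n0).
    by rewrite kn andbT (leq_ltn_trans (card_slot_ends _ _ _)).
  exact: bump_set_const.
apply: le_trans Hs.
have k0 : 0 < k%:R :> R by rewrite ltr0n; lia.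
have lr1 : 1 <= l%:R :> R by rewrite ler1n.
have Lle : ln (n%:R / k%:R) <= 3 * l%:R :> R.
  rewrite -[leRHS]expRK ler_ln ?posrE ?expR_gt0 ?divr_gt0 ?k0 ?ltr0n //.
  apply: (@le_trans _ _ (2 ^+ (3 * l))); last first.
    rewrite -natrM -[(3 * l)%:R]mul1r expRM_natr.
    apply: lerXn2r; rewrite ?nnegrE ?expR_ge0 //.
    by apply: le_trans (expR_ge1Dx 1); lra.
  rewrite ler_pdivrMr // -natrX -natrM ler_nat.
  have nK : (n < N.+1 * K)%N by rewrite /N ltn_ceil.
  apply: (@leq_trans (2 ^ p.+1 * k)); last first.
    by rewrite leq_mul2r leq_exp2l //; apply/orP; right; rewrite /l; lia.
  by apply: leq_trans (ltnW nK) _; apply: leq_mul => //; lia.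
have K4r : k%:R <= 4 * K%:R :> R by rewrite -natrM ler_nat.
have : k%:R * (1 + ln (n%:R / k%:R)) <= 4 * K%:R * (4 * l%:R) :> R.
  apply: (@le_trans _ _ (k%:R * (4 * l%:R))).
    by rewrite ler_wpM2l ?(ltW k0) //; lra.
  by rewrite ler_wpM2r // mulr_ge0.
lra.
Qed.

End LowerBound.

Theorem corollary2 (R : realType) :
  exists kappa1 kappa2 : R, [/\ 0 < kappa1, 0 < kappa2 &
    forall c1 c2 : R, kappa1 <= c1 -> kappa2 <= c2 ->
    exists2 C : R, 0 < C &
      forall r n k : nat, (2 <= r)%N -> (3 <= n)%N -> (3 <= k <= n)%N ->
      forall st : estimator R r n, is_EI_estimator c1 c2 st ->
      (sup_risk (pw_const_class R r n k) st
         <= C%:E * minimax_risk (pw_const_class R r n k))%E].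
Proof.
exists 128, 392; split; [by rewrite ltr0n | by rewrite ltr0n | move=> c1 c2 c1P c2P].
have C0 : 0 < 2 * (c1 + c2 + 272) * (16 * 512 / 3) by apply: mulr_gt0; lra.
exists (2 * (c1 + c2 + 272) * (16 * 512 / 3)); first exact: C0.
move=> r n k r2 _ kP st stP; have /andP[k3 kn] := kP.
(* The common order of both risks. *)
pose rate : R := k%:R * (1 + ln (n%:R / k%:R)).
apply: (@le_trans _ _ (2 * (c1 + c2 + 272) * rate)%:E).
  apply: ge_ereal_sup => _ [s sP <-]; rewrite lee_fin.
  by apply: EI_risk_le => //; apply: leq_trans k3.
have -> : 2 * (c1 + c2 + 272) * rate
   = 2 * (c1 + c2 + 272) * (16 * 512 / 3) * (3 / 512 / 16 * rate) by field.
rewrite EFinM lee_pmul2l ?lte_fin; last exact: C0; last by [].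
apply: le_ereal_inf_tmp => _ [shat _ <-].
have [s sP sr] := minimax_lower shat r2 kP.
apply: le_trans (ereal_sup_ubound _); last by exists s.
by rewrite lee_fin.
Qed.
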